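(* For every integer $n\ge 1$, \[ \mathcal F_{n+1}=\mathcal F_n\sqcup\{A\cup\{n+2\}:\ A\in\mathcal E_n\} \] (a disjoint union). Consequently, \[ N(n+1)=N(n)+E(n). \]
   Context: For an integer $n\ge 1$ let $X_n=\{2,3,\ldots,n+1\}$. A truncated residue profile of length $n$ is a tuple $r=(r_2,\ldots,r_n)$ with $r_k\in\mathbb Z/k\mathbb Z$ for each $2\le k\le n$ (the empty tuple if $n=1$). Its survivor set is \[ S_n(r)=\{m\in X_n:\ m\not\equiv r_k\pmod k\text{ for every } 2\le k<m\}. \] Let $\mathcal F_n=\{S_n(r): r \text{ a truncated profile of length } n\}$ and $N(n)=|\mathcal F_n|$. A set $A\in\mathcal F_n$ is called extendible if there exists a truncated profile $r=(r_2,\ldots,r_n)$ such that $S_n(r)=A$ and $r_k\not\equiv n+2\pmod k$ for every $2\le k\le n$. Let $\mathcal E_n\subseteq\mathcal F_n$ be the family of extendible sets and $E(n)=|\mathcal E_n|$. *)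

(* Defs.v *)
From HB Require Import structures.
From mathcomp Require Import all_boot all_order all_algebra.
From mathcomp Require Import finmap.

Set Implicit Arguments.
Unset Strict Implicit.
Unset Printing Implicit Defensive.

Local Open Scope nat_scope.
Local Open Scope fset_scope.

Definition Xset (n : nat) : {fset nat} := [fset m in iota 2 n].

(* The index i : 'I_n.-1 stands for the modulus k = i + 2, so that k ranges
   over 2, ..., n and r i : 'Z_(i.+2) is the residue class r_k in Z/kZ; the
   modulus is always at least 2, where 'Z_k really is Z/kZ. *)
Definition profile (n : nat) : finType :=
  {dffun forall i : 'I_n.-1, 'Z_(i.+2)}.

(* In 'Z_k, the element m%:R is the residue class of m modulo k. *)
Definition survivors (n : nat) (r : profile n) : {fset nat} :=
  [fset m in Xset n |
    [forall i : 'I_n.-1, (i.+2 < m) ==> (m%:R != r i :> 'Z_(i.+2))%R]].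

Definition survivor_family (n : nat) : {fset {fset nat}} :=
  [fset survivors r | r : profile n].

Definition extendible (n : nat) (A : {fset nat}) : bool :=
  [exists r : profile n, (survivors r == A) &&
    [forall i : 'I_n.-1, (r i != n.+2%:R :> 'Z_(i.+2))%R]].

Definition extendible_family (n : nat) : {fset {fset nat}} :=
  [fset A in survivor_family n | extendible n A].

Definition num_survivor_sets (n : nat) : nat := #|` survivor_family n|.

Definition num_extendible_sets (n : nat) : nat := #|` extendible_family n|.

(* Main.v *)
Require Import Defs.
From HB Require Import structures.
From mathcomp Require Import all_boot all_order all_algebra.
From mathcomp Require Import finmap.

Import GRing.Theory.

Local Open Scope fset_scope.

(** A profile of length [n+1] is a profile of length [n] together with one
    more residue, modulo [n+1].  Among the elements of [X_(n+1)], the new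
    residue constrains only [n+2], the one element exceeding [n+1]; hence the
    survivors of the long profile are those of its restriction, plus [n+2]
    exactly when every residue of the long profile avoids [n+2]
    ([survivors_restrict]).

    Conversely the last residue can be chosen freely ([extend]).  Taking it to
    be the class of [n+2] kills [n+2], so every survivor set of length [n] is
    one of length [n+1].  Taking it to be the class of [n+1], which differs
    from that of [n+2] because [1 <> 0] modulo [n+1], keeps [n+2] as soon as
    the short profile avoids it, which is extendibility.  Since [n+2] belongs
    to no survivor set of length [n], the two parts are disjoint and adding
    [n+2] is injective, which gives the count. *)

(** No residue of [r] is the class of [m]. *)
Definition avoids (n : nat) (r : profile n) (m : nat) : bool :=
  [forall i : 'I_n.-1, (r i != m%:R :> 'Z_(i.+2))%R].

(** The first residues of a profile, forgetting the last one.  The length is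
    written [p.+1] so that the index types are ['I_p] and ['I_p.+1]. *)
Definition restrict (p : nat) (r : profile p.+2) : profile p.+1 :=
  [ffun i : 'I_p => r (widen_ord (leqnSn p) i)].

(** The profile [r], of length [p+1], lengthened by the residue class of [c]
    modulo [p+2]. *)
Definition extend (p : nat) (r : profile p.+1) (c : nat) : profile p.+2 :=
  [ffun i : 'I_p.+1 =>
    match decP (@idP (i < p)) return 'Z_(i.+2) with
    | left i_lt_p => r (Ordinal i_lt_p)
    | right _ => (c%:R)%R
    end].

Lemma extendK (p : nat) (r : profile p.+1) (c : nat) :
  restrict p (extend p r c) = r.
Proof.
apply/ffunP => -[i i_lt_p]; rewrite !ffunE.
case: decP => [i_lt_p' | /(_ i_lt_p) //].
by rewrite (bool_irrelevance i_lt_p' i_lt_p).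
Qed.

Lemma extend_max (p : nat) (r : profile p.+1) (c : nat) :
  extend p r c ord_max = (c%:R)%R.
Proof.
rewrite ffunE; case: decP => // p_lt_p.
by have := p_lt_p; rewrite {1}ltnn.
Qed.

Lemma avoids_restrict (p : nat) (r : profile p.+2) (m : nat) :
  avoids p.+2 r m = avoids p.+1 (restrict p r) m && (r ord_max != m%:R)%R.
Proof.
apply/forallP/andP => [r_m | [/forallP r_m r_max] i].
  split; last exact: r_m.
  by apply/forallP => i; rewrite ffunE; apply: r_m.
case: (ltnP i p) => [i_lt_p | p_le_i].
  have -> : i = widen_ord (leqnSn p) (Ordinal i_lt_p) by apply: val_inj.
  by have := r_m (Ordinal i_lt_p); rewrite ffunE.
have -> // : i = ord_max.
by apply/val_inj/eqP; rewrite /= eqn_leq p_le_i -ltnS ltn_ord.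
Qed.

Lemma in_survivors (n : nat) (r : profile n) (m : nat) :
  (m \in survivors r) = (1 < m < n.+2) &&
    [forall i : 'I_n.-1, (i.+2 < m) ==> (m%:R != r i :> 'Z_(i.+2))%R].
Proof. by rewrite !inE /= mem_iota. Qed.

Lemma notin_survivors (n : nat) (r : profile n) : n.+2 \notin survivors r.
Proof. by rewrite in_survivors ltnn. Qed.

Lemma notin_survivor_family (n : nat) (A : {fset nat}) :
  A \in survivor_family n -> n.+2 \notin A.
Proof. by case/imfsetP => r _ ->; apply: notin_survivors. Qed.

Lemma survivors_restrict (p : nat) (r : profile p.+2) :
  survivors r = survivors (restrict p r) `|`
    (if avoids p.+2 r p.+3 then [fset p.+3] else fset0).
Proof.
apply/fsetP => m; rewrite in_fsetU.
have -> : (m \in if avoids p.+2 r p.+3 then [fset p.+3] else fset0) =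
          (m == p.+3) && avoids p.+2 r p.+3.
  by case: ifP => _; rewrite !inE ?andbT ?andbF.
case: (eqVneq m p.+3) => [-> | m_neq] /=.
  rewrite (negbTE (notin_survivors p.+1 _)) in_survivors ltnSn /=.
  apply: eq_forallb => i; rewrite eq_sym.
  by have -> : i.+2 < p.+3 by rewrite !ltnS -ltnS ltn_ord.
rewrite orbF !in_survivors [m < p.+4]ltnS [m <= p.+3]leq_eqVlt (negbTE m_neq) /=.
case: (boolP (1 < m < p.+3)) => //= /andP[_ m_lt].
apply/forallP/forallP => r_m i.
  by rewrite ffunE; apply: (r_m (widen_ord (leqnSn p) i)).
case: (ltnP i p) => [i_lt_p | p_le_i].
  have -> : i = widen_ord (leqnSn p) (Ordinal i_lt_p) by apply: val_inj.
  by have := r_m (Ordinal i_lt_p); rewrite ffunE.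
(* The last modulus [p+2] is not below [m <= p+2]. *)
by apply/implyP => /leq_trans/(_ m_lt); rewrite !ltnS ltnNge p_le_i.
Qed.

Lemma mem_survivor_family (n : nat) (r : profile n) :
  survivors r \in survivor_family n.
Proof. exact: in_imfset. Qed.

Lemma extendible_familyP (n : nat) (A : {fset nat}) :
  reflect (exists2 r : profile n, A = survivors r & avoids n r n.+2)
          (A \in extendible_family n).
Proof.
rewrite /extendible_family !inE /=; apply: (iffP andP).
  by case=> _ /existsP[r /andP[/eqP <- r_av]]; exists r.
case=> r -> r_av; split; first exact: mem_survivor_family.
by apply/existsP; exists r; rewrite eqxx.
Qed.

Theorem theorem23 (n : nat) (hn : (1 <= n)%N) :
  [/\ survivor_family n.+1 =
        survivor_family n `|` [fset A `|` [fset n.+2] | A in extendible_family n],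
      [disjoint survivor_family n
              & [fset A `|` [fset n.+2] | A in extendible_family n]]
    & num_survivor_sets n.+1 = (num_survivor_sets n + num_extendible_sets n)%N].
Proof.
case: n hn => // p _.
have familyE : survivor_family p.+2 = survivor_family p.+1 `|`
    [fset A `|` [fset p.+3] | A in extendible_family p.+1].
  apply/fsetP => B; rewrite in_fsetU; apply/idP/orP.
    case/imfsetP => r _ ->; rewrite survivors_restrict avoids_restrict.
    case: ifP => [/andP[r_av _] | _]; last first.
      by left; rewrite fsetU0 mem_survivor_family.
    by right; apply: in_imfset; apply/extendible_familyP; exists (restrict p r).
  case.
    case/imfsetP => r _ ->.
    have -> : survivors r = survivors (extend p r p.+3).
      by rewrite survivors_restrict avoids_restrict extendK extend_max eqxx
                 andbF fsetU0.
    exact: mem_survivor_family.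
  case/imfsetP => A /= /extendible_familyP[r -> r_av] ->.
  have -> : survivors r `|` [fset p.+3] = survivors (extend p r p.+2).
    rewrite survivors_restrict avoids_restrict extendK extend_max r_av /=.
    (* [p+3 = (p+2) + 1], and [1] is nonzero modulo [p+2]. *)
    by rewrite -[in X in _ != X]natr1 -subr_eq0 opprD addNKr oppr_eq0 oner_eq0.
  exact: mem_survivor_family.
have family_disj : [disjoint survivor_family p.+1 &
    [fset A `|` [fset p.+3] | A in extendible_family p.+1]].
  apply/fdisjointP => B /notin_survivor_family B_notin.
  apply: contra B_notin => /imfsetP[A _ ->].
  by rewrite in_fsetU in_fset1 eqxx orbT.
split=> //.
rewrite /num_survivor_sets /num_extendible_sets familyE.
rewrite cardfsU (disjoint_fsetI0 family_disj) cardfs0 subn0; congr (_ + _)%N.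
apply: card_in_imfset => A B /= A_ext B_ext eqAB.
have notinE C : C \in extendible_family p.+1 -> p.+3 \notin C.
  by case/extendible_familyP => r -> _; apply: notin_survivors.
rewrite -(fsetU1K (notinE A A_ext)) -(fsetU1K (notinE B B_ext)).
by rewrite ![p.+3 |` _]fsetUC eqAB.
Qed.
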